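(* Let $G$ be a finitely generated sofic group, let $M\subset G$ be a finite subset, let $A$ be a finite alphabet (a finite set), and let $S=A^{A^M}$. Suppose that $s\in S^G$ has uniformly bounded singularity and that $\sigma_s\colon A^G\to A^G$ is stably injective. Then $\sigma_s$ is stably invertible.
   Context: Sofic group (standard notion): $G$ is sofic if for every finite $K\subset G$ and every $\varepsilon>0$ there exist $n\ge 1$ and a map $\varphi\colon G\to \mathrm{Sym}(n)$ with $d_H(\varphi(gh),\varphi(g)\varphi(h))\le\varepsilon$ for all $g,h\in K$ and $d_H(\varphi(g),\varphi(h))\ge 1-\varepsilon$ for all distinct $g,h\in K$, where $d_H$ is the normalized Hamming distance. For a set $B$, $B^G$ is the set of maps (configurations) $G\to B$, with the prodiscrete topology (product of discrete topologies) and the shift action $(gx)(h)=x(g^{-1}h)$ for $g,h\in G$, $x\in B^G$. For $x\in B^G$, $\Sigma(x)=\overline{\{gx: g\in G\}}\subset B^G$. $S=A^{A^M}$ is the set of all maps $A^M\to A$. For $s\in S^G$, the non-uniform cellular automaton (NUCA) $\sigma_s\colon A^G\to A^G$ is defined by $\sigma_s(x)(g)=s(g)\big((g^{-1}x)|_M\big)$ for $x\in A^G$, $g\in G$. A configuration $s\in S^G$ has uniformly bounded singularity if for every finite $E\subset G$ with $1_G\in E=E^{-1}$ there is a finite $F\subset G$ containing $E$ such that the restriction $s|_{FE\setminus F}$ is constant. $\sigma_s$ is stably injective if $\sigma_p$ is injective for every $p\in\Sigma(s)\subset S^G$. $\sigma_s$ is stably invertible if there exist a finite set $N\subset G$ and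 $t\in T^G$, where $T=A^{A^N}$, such that for every $p\in\Sigma(s)$ there is some $q\in\Sigma(t)$ with $\sigma_p\circ\sigma_q=\sigma_q\circ\sigma_p=\mathrm{Id}$. *)

(* Defs.v *)
From HB Require Import structures.
From mathcomp Require Import all_boot all_order all_algebra all_fingroup finmap.
From mathcomp Require Import all_classical reals topology function_spaces.

Set Implicit Arguments.
Unset Strict Implicit.
Unset Printing Implicit Defensive.

Import GRing.Theory Num.Theory.

Local Open Scope classical_set_scope.
Local Open Scope ring_scope.

Definition finitely_generated (G : groupType) : Prop :=
  exists K : {fset G}, forall H : set G,
    group_closed (mem H) -> {subset K <= H} -> H = [set: G].

Definition hamming (R : realType) (n : nat) (a b : 'S_n) : R :=
  #|[set i | a i != b i]%SET|%:R / n%:R.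

(* The product of 'S_n applies its left factor first, so [phi h * phi g] is
   the composite of the maps phi(g) o phi(h). *)
Definition sofic (R : realType) (G : groupType) : Prop :=
  forall (K : {fset G}) (eps : R), 0 < eps ->
  exists n : nat, (1 <= n)%N /\
  exists phi : G -> 'S_n,
    (forall g h, g \in K -> h \in K ->
       hamming R (phi (g * h)%g) (phi h * phi g)%g <= eps) /\
    (forall g h, g \in K -> h \in K -> g != h ->
       1 - eps <= hamming R (phi g) (phi h)).

(* B^G with the prodiscrete topology. *)
Notation config G B := {ptws G -> discrete_topology B}.

Definition shift (G : groupType) (B : Type) (g : G) (x : G -> B) : G -> B :=
  fun h => x (g^-1 * h)%g.

Definition orbit_closure (G : groupType) (B : choiceType) (x : config G B) :
    set (config G B) :=
  closure [set y : config G B | exists g : G, y = shift g x].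

(* Local rules A^(A^M); the finite set M is used as a finite type. *)
Definition rule (G : groupType) (A : finType) (M : {fset G}) : finType :=
  {ffun {ffun M -> A} -> A}.

Definition nuca (G : groupType) (A : finType) (M : {fset G})
    (s : G -> rule A M) (x : G -> A) : G -> A :=
  fun g => s g [ffun m : M => shift g^-1%g x (val m)].

(* "s is constant on FE \ F" is equality of any two of its values there, so it
   holds vacuously when FE \ F is empty. *)
Definition uniformly_bounded_singularity (G : groupType) (B : Type)
    (s : G -> B) : Prop :=
  forall E : {fset G}, 1%g \in E -> E = [fset e^-1%g | e in E]%fset ->
  exists F : {fset G}, (E `<=` F)%fset /\
    let FE := [fset (f * e)%g | f in F, e in E]%fset in
    forall g h, g \in (FE `\` F)%fset -> h \in (FE `\` F)%fset -> s g = s h.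

Definition stably_injective (G : groupType) (A : finType) (M : {fset G})
    (s : G -> rule A M) : Prop :=
  forall p, orbit_closure s p -> injective (nuca p).

Definition stably_invertible (G : groupType) (A : finType) (M : {fset G})
    (s : G -> rule A M) : Prop :=
  exists (N : {fset G}) (t : G -> rule A N),
    forall p, orbit_closure s p ->
    exists q, orbit_closure t q /\
      nuca p \o nuca q = id /\ nuca q \o nuca p = id.

(* Main.v *)
Require Import Defs.
From mathcomp Require Import all_boot all_order all_algebra all_fingroup finmap.
From mathcomp Require Import all_classical reals topology function_spaces.
From mathcomp Require Import zify.

(** By compactness of the space of configurations, stable injectivity is
    uniform: there is a finite window N such that, for every p in the orbit
    closure of s, the values of sigma_p(x) on N determine x(1)
    ([stably_injective_window]).  Hence x(1) is computed from them by a local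
    rule that depends only on the restriction of p to N.  Applying this rule at
    every point gives an equivariant construction [decoding] that sends s to
    some t, sends the orbit closure of s into that of t, and satisfies
    sigma_(decoding p) o sigma_p = Id ([decodingK]).  The other composite is
    the identity as soon as it is so for s itself ([decoding_right_inverse]),
    so what is left to prove is that sigma_s is surjective.

    Surjectivity ([nuca_surjective]) is a counting argument in the style of
    Gromov and Weiss.  By compactness again, it is enough to produce every
    pattern y on a finite set E0.  Bounded singularity gives a finite F that
    contains E0 and such that s is equal to a constant c on FE \ F, where E is
    as large as needed.  When G is not covered by a finite neighbourhood of F,
    which is where finite generation enters ([generated_escape]), some
    translate of the window N lies in FE \ F, so the uniform rule c is decoded
    by the window N too.  Otherwise G is finite, and an injective self-map of
    the finite set A^G is surjective.

    Consider a sofic model of G, that is, a finite set V on which G almost acts,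
    and choose in it a maximal set Z of centres whose copies of FE are pairwise
    disjoint.  Write s on the copies of F and c elsewhere.  The resulting map
    [transplant] on A^V still determines w(v) at each good point v
    ([transplant_decodes]): the window around v either lies in a copy of FE,
    where the rules are those of s, or avoids all the copies of F, where they
    are equal to c.  So the image of [transplant] has at least |A|^(|V| - r)
    elements, r being the number of bad points.  If no x had sigma_s(x) = y on
    E0, every element of this image would differ from y on the copy of E0
    around each centre, which leaves at most (1 - 1/b)^|Z| |A|^|V| elements,
    with b = |A|^|E0| ([card_avoiding]).  As |Z| is at least proportional to
    |V| - r ([large_packing]) while r / |V| is arbitrarily small, the two bounds
    are incompatible. *)

Set Implicit Arguments.
Unset Strict Implicit.
Unset Printing Implicit Defensive.

Import GroupScope.

(** * The prodiscrete topology in terms of finite windows *)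

Section Prodiscrete.
Variables (T B : choiceType).
Implicit Types (E : {fset T}) (p : config T B).
Local Open Scope classical_set_scope.

Definition cylinder E p : set (config T B) := [set y : config T B | {in E, forall t, y t = p t}].

Lemma cylinder_nbhs E p : nbhs p (cylinder E p).
Proof.
have coord t : nbhs p [set y : config T B | y t = p t].
  exact: (@proj_continuous T (fun=> discrete_topology B) t p) (discrete_set1 _).
have: nbhs p (\bigcap_(t in [set` E]) [set y : config T B | y t = p t]).
  by apply: filter_bigI => t _.
exact: filterS.
Qed.

Lemma cvg_of_coords (F : set_system (config T B)) p : Filter F ->
  (forall t, F [set y | y t = p t]) -> F --> p.
Proof.
move=> FF Ft; apply/cvg_sup => t; apply/cvg_image.
  by rewrite eqEsubset; split=> // b _; exists (fun=> b).
move=> W /nbhs_singleton Wpt; exists ((fun y : config T B => y t) @^-1` W).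
  by apply: filterS (Ft t) => y /= ->.
by rewrite eqEsubset; split=> [_ [y ? <-] //|b Wb]; exists (fun=> b).
Qed.

(** Density is reduced to finite windows: the traces on A of the cylinders around
    p generate a filter, which converges to p. *)
Lemma closure_cylinderP (A : set (config T B)) p :
  closure A p <-> forall E, exists2 y, A y & {in E, forall t, y t = p t}.
Proof.
split=> [clAp E|meetA].
  by have [y [Ay]] := clAp _ (cylinder_nbhs E p); exists y.
rewrite closureEcvg.
pose F := filter_from [set: {fset T}] (fun E => cylinder E p `&` A).
have FF : Filter F.
  apply: filter_from_filter; first by exists fset0.
  move=> E E' _ _; exists (E `|` E')%fset => // y [yp Ay].
  by split; split=> // t tE; apply: yp; rewrite inE tE ?orbT.
exists F; first by apply: filter_from_proper => E _; have [y] := meetA E; exists y.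
split=> [|C AC]; last by exists fset0 => // y [_ /AC].
apply: cvg_of_coords => t; exists [fset t]%fset => // y [yp _].
by apply: yp; rewrite inE.
Qed.

End Prodiscrete.

(** The form in which compactness of B^T is used: the family z is a net indexed
    by the finite sets ordered by inclusion, and w is a cluster point of it. *)
Lemma finite_alphabet_cluster (T : choiceType) (B : finType)
    (z : {fset T} -> T -> B) :
  exists w : T -> B, forall E, exists2 N, (E `<=` N)%fset & {in E, z N =1 w}.
Proof.
pose F : set_system (config T B) :=
  filter_from [set: {fset T}] (fun E y => exists2 N, (E `<=` N)%fset & y = z N).
have PF : ProperFilter F.
  apply: filter_from_proper; last by move=> E _; exists (z E); exists E.
  apply: filter_from_filter; first by exists fset0.
  move=> E E' _ _; exists (E `|` E')%fset => // y [N].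
  by rewrite fsubUset => /andP[EN E'N] ->; split; exists N.
have compT : forall t : T, compact [set: discrete_topology B].
  by move=> t; apply: finite_compact; exact: (@finite_finset B).
have [|w [_ Fw]] := tychonoff compT PF; first by exists fset0.
exists w => E.
have FE : F (fun y => exists2 N, (E `<=` N)%fset & y = z N) by exists E.
have [y [[N EN ->] zw]] := Fw _ _ FE (cylinder_nbhs (E : {fset T}) w).
by exists N.
Qed.

(** * Decoding a stably injective cellular automaton *)

Section OrbitClosure.
Variables (G : groupType) (B : choiceType).
Implicit Types (s p : G -> B).

Lemma orbit_closureP s p :
  orbit_closure s p <->
  forall E : {fset G}, exists g, {in E, forall h, p h = s (g * h)}.
Proof.
rewrite /orbit_closure closure_cylinderP; split=> meet E.
  have [_ [g ->] sp] := meet E; exists g^-1 => h hE.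
  by rewrite -sp.
have [g sp] := meet E; exists (shift g^-1 s); first by exists g^-1.
by move=> h hE; rewrite /shift invgK sp.
Qed.

Lemma orbit_closure_translate s p g :
  orbit_closure s p -> orbit_closure s (fun h => p (g * h)).
Proof.
move=> /orbit_closureP sp; apply/orbit_closureP => E.
have [k pk] := sp [fset g * h | h in E]%fset.
by exists (k * g) => h hE; rewrite -mulgA pk // in_imfset.
Qed.

Lemma orbit_closure_refl s : orbit_closure s s.
Proof. by apply/orbit_closureP => E; exists 1 => h _; rewrite mul1g. Qed.

End OrbitClosure.

Section Decoding.
Variables (G : groupType) (A : finType) (M : {fset G}).
Implicit Types (p s : G -> rule A M) (x y : G -> A) (N : {fset G}).

Lemma nucaE (L : {fset G}) (p : G -> rule A L) x g :
  nuca p x g = p g [ffun m => x (g * val m)].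
Proof. by rewrite /nuca /shift invgK. Qed.

Lemma eq_nuca (L : {fset G}) (p q : G -> rule A L) x y g h :
  p g = q h -> (forall m, m \in L -> x (g * m) = y (h * m)) ->
  nuca p x g = nuca q y h.
Proof.
move=> pq xy; rewrite !nucaE pq; congr (q h _).
by apply/ffunP => m; rewrite !ffunE xy // fsvalP.
Qed.

Definition decoding_window N p g := forall x y,
  (forall n, n \in N -> nuca p x (g * n) = nuca p y (g * n)) -> x g = y g.

(** Otherwise each finite N has a counterexample: p in the orbit closure, with x
    and y that differ at 1 although their images agree on N.  A cluster point of
    these triples is an element of the closed orbit closure whose automaton
    identifies two configurations that differ at 1. *)
Lemma stably_injective_window s : stably_injective s ->
  exists2 N, 1 \in N & forall p, orbit_closure s p -> decoding_window N p 1.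
Proof.
move=> sinj; apply: contrapT => noN.
have bad N : exists z : (G -> rule A M) * (G -> A) * (G -> A),
    [/\ orbit_closure s z.1.1, z.1.2 1 <> z.2 1 &
        {in N, nuca z.1.1 z.1.2 =1 nuca z.1.1 z.2}].
  apply: contrapT => noz; apply: noN.
  exists (1 |` N)%fset => [|p sp x y xyN]; first by rewrite !inE eqxx.
  apply: contrapT => xy1; apply: noz; exists (p, x, y); split=> //= n nN.
  by rewrite -[n]mul1g xyN // inE nN orbT.
have [z zP] := boolp.choice bad.
have [w wP] := finite_alphabet_cluster
  (fun N g => ((z N).1.1 g, (z N).1.2 g, (z N).2 g)).
pose p g := (w g).1.1; pose x g := (w g).1.2; pose y g := (w g).2.
have {}wP E : exists N, [/\ (E `<=` N)%fset, {in E, (z N).1.1 =1 p},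
    {in E, (z N).1.2 =1 x} & {in E, (z N).2 =1 y}].
  by have [N EN zw] := wP E; exists N; split=> // g /zw; rewrite /p /x /y => <-.
have sp : orbit_closure s p.
  apply/orbit_closureP => E; have [N [EN zp _ _]] := wP E.
  have [/orbit_closureP/(_ E)[g gP] _ _] := zP N.
  by exists g => h hE; rewrite -zp // gP.
have xy1 : x 1 <> y 1.
  have [N [_ _ zx zy]] := wP [fset 1]%fset; have [_ + _] := zP N.
  by rewrite zx ?inE // zy ?inE.
apply: xy1; congr (_ 1); apply: (sinj p sp); apply: funext => g.
have [N [EN zp zx zy]] := wP (g |` [fset g * m | m in M])%fset.
have [_ _ zxy] := zP N.
have inE1 : g \in (g |` [fset g * m | m in M])%fset by rewrite !inE eqxx.
have inEM m : m \in M -> g * m \in (g |` [fset g * m | m in M])%fset.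
  by move=> mM; rewrite inE in_imfset ?orbT.
transitivity (nuca (z N).1.1 (z N).1.2 g).
  by apply: eq_nuca => [|m mM]; rewrite ?zp ?zx // inEM.
rewrite zxy; last exact: (fsubsetP EN).
by apply: eq_nuca => [|m mM]; rewrite ?zp ?zy // inEM.
Qed.

(** P is the family of local rules seen on N and u the family of images.  The
    value is the common x(1) of all the configurations x whose image under P is
    u, when there are some.  The default u(1) is the reason for requiring 1 in N:
    the alphabet may be empty, so no default is available outside u. *)
Definition decoder N (N1 : 1 \in N) (P : {ffun N -> rule A M}) : rule A N :=
  [ffun u : {ffun N -> A} =>
     odflt (u [` N1]%fset)
       [pick a | `[< exists2 x : G -> A, x 1 = a &
          forall n : N, P n [ffun m => x (val n * val m)] = u n >]]].

Definition decoding N (N1 : 1 \in N) p : G -> rule A N :=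
  fun g => decoder N1 [ffun n => p (g * val n)].

Variables (N : {fset G}) (N1 : 1 \in N) (s : G -> rule A M).
Hypothesis sN : forall p, orbit_closure s p -> decoding_window N p 1.

Lemma decoding_window_translate p g : orbit_closure s p -> decoding_window N p g.
Proof.
move=> sp x y xy.
have := sN (orbit_closure_translate (g := g) sp)
  (x := fun h => x (g * h)) (y := fun h => y (g * h)).
rewrite mulg1; apply=> n nN.
have shiftE z : nuca (fun h => p (g * h)) (fun h => z (g * h)) (1 * n) = nuca p z (g * n).
  by rewrite mul1g; apply: eq_nuca => // m _; rewrite mulgA.
by rewrite !shiftE xy.
Qed.

Lemma decodingK p : orbit_closure s p -> nuca (decoding N1 p) \o nuca p = id.
Proof.
move=> sp; apply: funext => x; apply: funext => g /=.
rewrite nucaE ffunE; case: pickP => [a /asboolP[x' <- x'P]|/(_ (x g))/asboolP[]].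
  have := decoding_window_translate (g := g) sp (x := fun h => x' (g^-1 * h)) (y := x).
  rewrite mulVg; apply=> n nN.
  have := x'P [` nN]%fset; rewrite !ffunE /= => <-.
  by rewrite nucaE; congr (p _ _); apply/ffunP => m; rewrite !ffunE -mulgA mulKg.
exists (fun h => x (g * h)); first by rewrite mulg1.
by move=> n; rewrite !ffunE nucaE; congr (p _ _); apply/ffunP => m; rewrite !ffunE mulgA.
Qed.

(** The decoder at h reads p on hN only, so a translate of s that approximates p
    on EN is sent to a translate that approximates the decoding of p on E. *)
Lemma decoding_orbit_closure p :
  orbit_closure s p -> orbit_closure (decoding N1 s) (decoding N1 p).
Proof.
move=> /orbit_closureP sp; apply/orbit_closureP => E.
have [g pg] := sp [fset h * n | h in E, n in N]%fset.
exists g => h hE; rewrite /decoding; congr decoder; apply/ffunP => n.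
by rewrite !ffunE pg ?mulgA // in_imfset2 // fsvalP.
Qed.

(** The composite at g only sees p and y on a finite window, where p is a
    translate of s. *)
Lemma decoding_right_inverse p : orbit_closure s p ->
  nuca s \o nuca (decoding N1 s) = id -> nuca p \o nuca (decoding N1 p) = id.
Proof.
move=> /orbit_closureP sp sK; apply: funext => y; apply: funext => g /=.
have [k pk] := sp (g |` [fset g * m | m in M] `|`
  [fset gm * n | gm in [fset g * m | m in M], n in N])%fset.
have := congr1 (fun f => f (fun h => y (k^-1 * h)) (k * g)) sK.
rewrite /= mulKg => <-; apply: eq_nuca => [|m mM].
  by rewrite pk // !inE eqxx.
apply: eq_nuca => [|n nN]; last by rewrite !mulgA mulVg mul1g.
rewrite /decoding; congr decoder; apply/ffunP => n.
rewrite !ffunE pk ?mulgA // !inE; apply/orP; right.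
by rewrite in_imfset2 ?fsvalP // in_imfset.
Qed.

End Decoding.

(** * Finite models of sofic groups *)

Section SoficModel.
Import Order.TTheory GRing.Theory Num.Theory.
Variables (R : realType) (G : groupType).

(** The points where [act] looks like the right regular action of G, at the scale
    of W: products are respected, and distinct elements have distinct effects. *)
Definition model_point (V : finType) (act : G -> V -> V) (W : {fset G}) : {set V} :=
  [set v | [forall g : W, forall h : W,
    (act (val g * val h) v == act (val h) (act (val g) v)) &&
    ((act (val g) v == act (val h) v) ==> (g == h))]]%SET.

Lemma hamming_le n (a b : 'S_n) (D : nat) : (0 < n)%N -> (0 < D)%N ->
  (hamming R a b <= D%:R^-1)%R = (D * #|[set i | a i != b i]%SET| <= n)%N.
Proof.
move=> n0 D0; rewrite /hamming ler_pdivrMr ?ltr0n // mulrC ler_pdivlMr ?ltr0n //.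
by rewrite -natrM ler_nat mulnC.
Qed.

Lemma card_sub_setC n (S B : {set 'I_n}) :
  B \subset ~: S -> (#|B| <= n - #|S|)%N.
Proof. by move/subset_leq_card; rewrite [leqRHS]cardsCs finset.setCK card_ord. Qed.

(** Inverses turn the approximate left action phi into a right one, which is what
    the neighbourhoods gM of an automaton require.  Each pair of elements of W
    excludes at most 2n/D points, and D is taken large enough to absorb the
    number of pairs. *)
Lemma sofic_model (W : {fset G}) (Q : nat) : sofic R G ->
  exists (n : nat) (act : G -> 'I_n -> 'I_n),
    [/\ (0 < n)%N, forall g, injective (act g) &
        (Q * #|~: model_point act W| <= n)%N].
Proof.
pose D := (2 * #|{: W * W}| * Q).+1.
have D0 : (0 < D%:R :> R)%R by rewrite ltr0n.
move=> /(_ [fset g^-1 | g in W]%fset D%:R^-1%R); rewrite invr_gt0 => /(_ D0).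
move=> [n [n0 [phi [phiM phi_inj]]]].
exists n, (fun g => phi g^-1); split=> // [g|]; first exact: perm_inj.
pose B (gh : W * W) : {set 'I_n} :=
  ([set i | phi (val gh.1 * val gh.2)^-1 i != (phi (val gh.1)^-1 * phi (val gh.2)^-1) i]
   :|: [set i | (gh.1 != gh.2) && (phi (val gh.1)^-1 i == phi (val gh.2)^-1 i)])%SET.
have Winv (g : W) : (val g)^-1 \in [fset g^-1 | g in W]%fset.
  by rewrite in_imfset // fsvalP.
have cardB gh : (D * #|B gh| <= 2 * n)%N.
  apply: leq_trans (leq_mul (leqnn D) (leq_card_setU _ _)) _; rewrite mulnDr.
  rewrite mul2n -addnn; apply: leq_add.
    by rewrite -hamming_le // invMg phiM.
  have [->|neq] := eqVneq gh.1 gh.2.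
    by rewrite (_ : [set _ | _]%SET = finset.set0) ?cards0 ?muln0 //; apply/setP=> i; rewrite !inE eqxx.
  have := phi_inj _ _ (Winv gh.1) (Winv gh.2).
  rewrite (inj_eq invg_inj) (inj_eq val_inj) => /(_ neq).
  rewrite lerBlDr -lerBlDl /hamming -{1}(@divff _ n%:R%R) ?pnatr_eq0 -?lt0n //.
  rewrite -mulrBl -natrB; last by rewrite -[leqRHS]card_ord max_card.
  rewrite ler_pdivrMr ?ltr0n // mulrC ler_pdivlMr // -natrM ler_nat mulnC.
  apply: leq_trans; rewrite leq_mul2l; apply/orP; right.
  by apply: card_sub_setC; apply/fintype.subsetP => i; rewrite !inE negbK => /andP[].
have sub : ~: model_point (fun g => phi g^-1) W \subset \bigcup_gh B gh.
  apply/fintype.subsetP => v; rewrite !inE negb_forall => /existsP[g].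
  rewrite negb_forall => /existsP[h]; rewrite negb_and negb_imply => bad.
  by apply/bigcupP; exists (g, h) => //; rewrite !inE /= permM andbC.
have {sub}le1 : (#|~: model_point (fun g => phi g^-1) W| <= \sum_gh #|B gh|)%N.
  apply: leq_trans (subset_leq_card sub) _.
  elim/big_ind2: _ => [|m1 X1 m2 X2 le1 le2|//]; first by rewrite cards0.
  by apply: leq_trans (leq_card_setU _ _) _; apply: leq_add.
have le2 : (D * \sum_gh #|B gh| <= #|{: W * W}| * (2 * n))%N.
  by rewrite big_distrr /= -sum_nat_const; apply: leq_sum.
rewrite -(leq_pmul2l (ltn0Sn _ : 0 < D)%N).
apply: (@leq_trans (Q * (#|{: W * W}| * (2 * n)))%N).
  by rewrite mulnCA leq_mul2l (leq_trans _ le2) ?orbT // leq_mul2l le1 orbT.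
by rewrite /D; lia.
Qed.

End SoficModel.

Section ModelPoints.
Variables (G : groupType) (V : finType) (act : G -> V -> V) (W : {fset G}).

Lemma model_pointM v g h : v \in model_point act W -> g \in W -> h \in W ->
  act (g * h) v = act h (act g v).
Proof.
rewrite inE => /forallP vP gW hW.
by have /forallP/(_ [` hW]%fset)/andP[/eqP] := vP [` gW]%fset.
Qed.

Lemma model_point_inj v : v \in model_point act W -> {in W &, injective (act^~ v)}.
Proof.
rewrite inE => /forallP vP g h gW hW /eqP gh.
have /forallP/(_ [` hW]%fset)/andP[_ /implyP/(_ gh)/eqP] := vP [` gW]%fset.
by move/(congr1 val).
Qed.

Hypothesis act_inj : forall g, injective (act g).

Lemma model_point1 v : v \in model_point act W -> 1 \in W -> act 1 v = v.
Proof. by move=> vP W1; apply: (act_inj (g := 1)); rewrite -model_pointM ?mulg1. Qed.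

Definition packing (D : {fset G}) (Z : {set V}) : bool :=
  (Z \subset model_point act W) &&
  [forall z in Z, forall z' in Z, forall d : D, forall d' : D,
    (act (val d) z == act (val d') z') ==> (z == z')].

Lemma packingP (D : {fset G}) (Z : {set V}) : reflect
  (Z \subset model_point act W /\ {in Z &, forall z z', forall d d', d \in D ->
     d' \in D -> act d z = act d' z' -> z = z'}) (packing D Z).
Proof.
apply: (iffP andP) => -[ZW ZD]; split=> //.
  move=> z z' zZ z'Z d d' dD d'D /eqP zz'; apply/eqP.
  have /forall_inP/(_ _ z'Z)/forallP/(_ [` dD]%fset)/forallP := forall_inP ZD _ zZ.
  by move=> /(_ [` d'D]%fset)/implyP; apply.
apply/forall_inP => z zZ; apply/forall_inP => z' z'Z; apply/forallP => d.
apply/forallP => d'; apply/implyP => /eqP zz'; apply/eqP.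
by apply: ZD zz'; rewrite ?fsvalP.
Qed.

(** In a maximal packing the copy of D around any good point v meets the copy
    around some centre z.  As [act d] is injective, v is then determined by z
    and the two elements of D that give the common point. *)
Lemma large_packing (D : {fset G}) : 1 \in D ->
  exists2 Z, packing D Z & (#|model_point act W| <= #|Z| * (#|` D| * #|` D|))%N.
Proof.
move=> D1.
have [|Z /maxsetP[pZ maxZ]] := @ex_maxset _ (packing D).
  exists finset.set0; apply/packingP; split; first by rewrite finset.sub0set.
  by move=> z z'; rewrite inE.
exists Z => //; have [ZW ZD] := packingP _ _ pZ.
pose f (q : V * (D * D)) := finv (act (val q.2.1)) (act (val q.2.2) q.1).
suff sub : model_point act W \subset f @: finset.setX Z [set: D * D]%SET.
  apply: leq_trans (subset_leq_card sub) (leq_trans (leq_imset_card _ _) _).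
  by rewrite cardsX cardsT card_prod -!cardfE.
apply/fintype.subsetP => v vW.
suff [z zZ [d dD [d' d'D vz]]] : exists2 z, z \in Z & exists2 d, d \in D &
    exists2 d', d' \in D & act d v = act d' z.
  apply/imsetP; exists (z, ([` dD]%fset, [` d'D]%fset)); first by rewrite !inE zZ.
  by rewrite /f /= -vz finv_f.
apply: contrapT => far.
have vZ : v \notin Z by apply/negP => vZ; apply: far; exists v => //; exists 1 => //; exists 1.
have /maxZ : packing D (v |: Z).
  apply/packingP; split; first by rewrite finset.subUset finset.sub1set vW.
  move=> z z' /setU1P[->|zZ] /setU1P[->|z'Z] d d' dD d'D // zz'.
  - by case: far; exists z' => //; exists d => //; exists d'.
  - by case: far; exists z => //; exists d' => //; exists d.
  - exact: ZD zz'.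
rewrite finset.subsetUr => /(_ isT) eqZ.
by move: vZ; rewrite -eqZ !inE eqxx.
Qed.

End ModelPoints.

(** * Counting configurations that avoid a pattern *)

Section Avoidance.
Variables (V A D : finType) (blk : V -> D -> V) (y : D -> A).
Local Open Scope nat_scope.

Definition avoiding (Z : {set V}) : {set {ffun V -> A}} :=
  [set w : {ffun V -> A} | [forall z in Z, exists d, w (blk z d) != y d]]%SET.

Let b := #|A| ^ #|D|.

(** Among the configurations that avoid y on the blocks of Z, at least one in b
    equals y on the block of z: overwriting this block by y preserves the other
    constraints, and the overwritten values are one of b possible patterns. *)
Lemma card_avoiding_setU1 (Z : {set V}) z : injective (blk z) ->
  (forall z' d d', z' \in Z -> blk z d <> blk z' d') ->
  b * #|avoiding (z |: Z)| <= b.-1 * #|avoiding Z|.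
Proof.
move=> blk_inj disj.
pose hits := (avoiding Z :&: [set w : {ffun V -> A} | [forall d, w (blk z d) == y d]])%SET.
have -> : avoiding (z |: Z) = (avoiding Z :\: hits)%SET.
  apply/setP => w; rewrite !inE negb_and negb_forall.
  apply/forall_inP/andP => [wP|[wz /forall_inP wZ] z' /setU1P[->|/wZ//]].
    have wZ : [forall z0 in Z, exists d, w (blk z0 d) != y d].
      by apply/forall_inP => z' z'Z; apply: wP; rewrite inE z'Z orbT.
    by rewrite wZ /=; split=> //; apply: wP; rewrite !inE eqxx.
  by case/orP: wz => // /negP[]; apply/forall_inP.
have hitsZ : hits \subset avoiding Z by exact: finset.subsetIl.
suff : #|avoiding Z| <= b * #|hits|.
  rewrite cardsD (finset.setIidPr hitsZ); move: (subset_leq_card hitsZ).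
  by case: b => [|c] /=; nia.
pose over (w : {ffun V -> A}) : {ffun V -> A} :=
  [ffun v => if [pick d | blk z d == v] is Some d then y d else w v].
have over_in w d : over w (blk z d) = y d.
  rewrite ffunE; case: pickP => [d' /eqP/blk_inj->//|/(_ d)].
  by rewrite eqxx.
have over_out w v : (forall d, blk z d <> v) -> over w v = w v.
  by move=> out; rewrite ffunE; case: pickP => // d /eqP/out.
pose f w := (over w, [ffun d => w (blk z d)] : {ffun D -> A}).
have f_inj : injective f.
  move=> w w' [ow iw]; apply/ffunP => v.
  have [[d <-]|out] := pselect (exists d, blk z d = v).
    by have := congr1 (fun u : {ffun D -> A} => u d) iw; rewrite !ffunE.
  have {}out d : blk z d <> v by move=> dv; apply: out; exists d.
  by rewrite -(over_out w) // -(over_out w') // ow.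
have -> : b * #|hits| = #|finset.setX hits [set: {ffun D -> A}]%SET|.
  by rewrite cardsX cardsT card_ffun mulnC.
rewrite -(card_imset _ f_inj); apply/subset_leq_card/fintype.subsetP => _ /imsetP[w wP ->].
rewrite !inE /= andbT; apply/andP; split; last first.
  by apply/forallP => d; rewrite over_in.
apply/forall_inP => z' z'Z; move: wP; rewrite inE => /forall_inP/(_ _ z'Z).
by move=> /existsP[d wd]; apply/existsP; exists d; rewrite over_out // => d'; apply: disj.
Qed.

Lemma card_avoiding (Z : {set V}) :
  {in Z, forall z, injective (blk z)} ->
  {in Z &, forall z z', z != z' -> forall d d', blk z d <> blk z' d'} ->
  b ^ #|Z| * #|avoiding Z| <= b.-1 ^ #|Z| * #|A| ^ #|V|.
Proof.
move: {2}#|Z| (erefl #|Z|) => k; elim: k Z => [|k IHk] Z cardZ blk_inj disj.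
  by rewrite cardZ !mul1n -card_ffun max_card.
have [z zZ] : exists z, z \in Z by apply/card_gt0P; rewrite cardZ.
have cardZz : #|Z :\ z| = k by have := cardsD1 z Z; rewrite zZ cardZ => -[].
have Zz z' : z' \in Z :\ z -> (z != z') /\ z' \in Z.
  by rewrite !inE eq_sym => /andP.
have := IHk _ cardZz; rewrite cardZz cardZ !expnS => {}IHk.
have step : b * #|avoiding Z| <= b.-1 * #|avoiding (Z :\ z)|.
  rewrite -{1}(finset.setD1K zZ); apply: card_avoiding_setU1; first exact: blk_inj.
  by move=> z' d d' /Zz[zz' z'Z]; apply: disj.
have {}IHk : b ^ k * #|avoiding (Z :\ z)| <= b.-1 ^ k * #|A| ^ #|V|.
  apply: IHk => [z' /Zz[_]|z1 z2 /Zz[_ Z1] /Zz[_ Z2]]; first exact: blk_inj.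
  exact: disj.
rewrite (mulnC b) -!mulnA; apply: leq_trans (leq_mul (leqnn _) step) _.
by rewrite mulnCA leq_mul.
Qed.

End Avoidance.

Section Growth.
Local Open Scope nat_scope.

(** Bernoulli's inequality (1 + 1/c)^n >= 1 + n/c without denominators. *)
Lemma bernoulli_expn c n : c ^ n * (c + n) <= c * c.+1 ^ n.
Proof.
elim: n => [|n IHn]; first by rewrite addn0 mulnC.
rewrite !expnS; move: (c ^ n) (c.+1 ^ n) IHn => u v IHn.
apply: (@leq_trans (c.+1 * (u * (c + n)))); first by nia.
by rewrite [leqRHS]mulnCA leq_mul2l IHn orbT.
Qed.

(** Since (b / (b - 1))^L is unbounded, enough independent constraints, each of
    which excludes a proportion 1/b, compensate one free letter of an alphabet
    of size a. *)
Lemma exp_gap a b : 0 < b -> exists L, a * b.-1 ^ L <= b ^ L.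
Proof.
case: b => // c _; exists (a * c).+1.
have [->|c0] := posnP c; first by rewrite muln0 !expn1 muln0.
rewrite -(leq_pmul2l c0); apply: leq_trans (bernoulli_expn _ _).
by rewrite mulnA mulnC leq_mul2l mulnC addnS ltnW ?orbT // ltnS leq_addl.
Qed.

Lemma exp_gap_lt a b L r k : 0 < b ->
  a * b.-1 ^ L <= b ^ L -> L * r < k -> a ^ r * b.-1 ^ k < b ^ k.
Proof.
case: b => // c _ gap Lrk; rewrite -(subnKC (ltnW Lrk)) !expnD mulnA.
apply: (@leq_ltn_trans (c.+1 ^ (L * r) * c ^ (k - L * r))).
  rewrite leq_mul2r !expnM -expnMn; case: r {Lrk} => [|r]; first by rewrite orbT.
  by rewrite leq_exp2r ?gap ?orbT.
by rewrite ltn_pmul2l ?expn_gt0 // ltn_exp2r ?subn_gt0.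
Qed.

End Growth.

(** * Transplanting a cellular automaton to a finite model *)

Section Transplant.
Variables (G : groupType) (A : finType) (M N F D : {fset G}).
Variables (s : G -> rule A M) (c : rule A M).
Hypotheses (N1 : 1 \in N) (FD : (F `<=` D)%fset).
Hypothesis sN : forall g, decoding_window N s g.
Hypothesis cN : decoding_window N (fun=> c) 1.
Hypothesis sc : forall g, g \in (D `\` F)%fset -> s g = c.
Hypothesis DN : forall f n n', f \in F -> n \in N -> n' \in N -> f * n^-1 * n' \in D.

(** Every product that is transferred from G to the model below has its two
    factors in this set. *)
Definition transplant_window := (D `|` M `|` (N `|` [fset n^-1 | n in N]))%fset.

Variables (V : finType) (act : G -> V -> V) (Z : {set V}).
Hypothesis act_inj : forall g, injective (act g).
Hypothesis Zpack : packing act transplant_window D Z.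

Definition transplanted_rule (v : V) : rule A M :=
  if [pick zf : V * F | (zf.1 \in Z) && (act (val zf.2) zf.1 == v)] is Some zf
  then s (val zf.2) else c.

Definition transplant (w : {ffun V -> A}) : {ffun V -> A} :=
  [ffun v => transplanted_rule v [ffun m : M => w (act (val m) v)]].

Let inD d : d \in D -> d \in transplant_window. Proof. by move=> dD; rewrite !inE dD. Qed.
Let inM m : m \in M -> m \in transplant_window. Proof. by move=> mM; rewrite !inE mM ?orbT. Qed.
Let inN n : n \in N -> n \in transplant_window. Proof. by move=> nN; rewrite !inE nN ?orbT. Qed.
Let inNV n : n \in N -> n^-1 \in transplant_window.
Proof. by move=> nN; rewrite !inE (in_imfset _ _ nN) ?orbT. Qed.

Let ZW : Z \subset model_point act transplant_window. Proof. by case/packingP: Zpack. Qed.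
Let Zmodel z : z \in Z -> z \in model_point act transplant_window.
Proof. exact: (fintype.subsetP ZW). Qed.

Let modelM := @model_pointM _ _ act transplant_window.

Lemma transplanted_ruleE z d : z \in Z -> d \in D -> transplanted_rule (act d z) = s d.
Proof.
have [_ ZD] := packingP _ _ _ _ Zpack.
move=> zZ dD; rewrite /transplanted_rule; case: pickP => [[z' f] /= /andP[z'Z /eqP zz']|].
  have fD : val f \in D by apply: (fsubsetP FD); rewrite fsvalP.
  have z'z := ZD _ _ z'Z zZ _ _ fD dD zz'; rewrite z'z in zz' *.
  by congr s; apply: (model_point_inj (Zmodel zZ)) zz'; apply: inD.
move=> none; rewrite sc // inE dD andbT; apply/negP => dF.
by have := none (z, [` dF]%fset); rewrite /= zZ eqxx.
Qed.

Lemma transplanted_rule_out v :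
  (forall z f, z \in Z -> f \in F -> act f z <> v) -> transplanted_rule v = c.
Proof.
move=> out; rewrite /transplanted_rule; case: pickP => // -[z f] /= /andP[zZ /eqP].
by move/out; case; rewrite ?fsvalP.
Qed.

Lemma transplantE (p : G -> rule A M) w v g :
  v \in model_point act transplant_window -> g \in transplant_window ->
  transplanted_rule (act g v) = p g ->
  transplant w (act g v) = nuca p (fun h => w (act h v)) g.
Proof.
move=> vW gW pg; rewrite ffunE nucaE pg; congr (p g _); apply/ffunP => m.
by rewrite !ffunE modelM // inM // fsvalP.
Qed.

Lemma transplant_inside w z d : z \in Z -> d \in D ->
  transplant w (act d z) = nuca s (fun h => w (act h z)) d.
Proof.
move=> zZ dD; apply: transplantE; [exact: Zmodel|exact: inD|].
exact: transplanted_ruleE.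
Qed.

(** Read around a centre z or around v itself, [transplant] is sigma_s or sigma_c
    on a window gN.  If v is not reached from a centre by some g with gN inside
    D, then no copy of F meets the window of v: a common point of vN and zF
    would give such a g in F N^-1. *)
Lemma transplant_decodes w w' v : transplant w = transplant w' ->
  v \in model_point act transplant_window -> w v = w' v.
Proof.
move=> ww' vW.
have [[z zZ [g gN <-]]|out] := pselect (exists2 z, z \in Z &
    exists2 g, (forall n, n \in N -> g * n \in D) & act g z = v).
  apply: (sN (x := fun h => w (act h z)) (y := fun h => w' (act h z))) => n /gN gnD.
  by rewrite -!transplant_inside // ww'.
rewrite -(model_point1 act_inj vW (inN N1)).
apply: (cN (x := fun h => w (act h v)) (y := fun h => w' (act h v))) => n nN.
have rc : transplanted_rule (act n v) = c.
  apply: transplanted_rule_out => z f zZ fF zf; apply: out; exists z => //.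
  exists (f * n^-1) => [n' n'N|]; first exact: DN.
  rewrite modelM ?Zmodel ?inNV ?inD ?(fsubsetP FD) // zf.
  by rewrite -modelM ?inNV ?inN // mulgV (model_point1 act_inj vW (inN N1)).
rewrite mul1g -!(transplantE (p := fun=> c)) ?inN //; by rewrite ww'.
Qed.

(** A configuration is recovered from its image together with its values at the
    bad points. *)
Lemma card_transplant_image :
  (#|A| ^ #|V| <= #|transplant @: [set: {ffun V -> A}]%SET| *
                  #|A| ^ #|~: model_point act transplant_window|)%N.
Proof.
set B := ~: model_point act transplant_window.
pose f (w : {ffun V -> A}) :=
  (transplant w, [ffun v : {v | v \in B} => w (val v)] : {ffun {v | v \in B} -> A}).
have f_inj : injective f.
  move=> w w' [tw bw]; apply/ffunP => v.
  have [vB|] := boolP (v \in B).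
    have := congr1 (fun u : {ffun {v | v \in B} -> A} => u (exist _ v vB)) bw.
    by rewrite !ffunE.
  by rewrite inE negbK; apply: transplant_decodes.
have -> : (#|A| ^ #|B| = #|[set: {ffun {v | v \in B} -> A}]%SET|)%N.
  by rewrite cardsT card_ffun card_sig.
rewrite -cardsX -card_ffun -(card_imset _ f_inj).
apply/subset_leq_card/fintype.subsetP => _ /imsetP[w _ ->].
by rewrite !inE andbT; apply/imset_f; rewrite inE.
Qed.

End Transplant.

(** * Surjectivity *)

Section Surjectivity.
Variables (R : realType) (G : groupType) (A : finType) (M : {fset G}).

(** In a model with n points, r of them bad, the image of the transplanted map has
    at least |A|^(n - r) elements.  This is too many if the pattern y is not
    reached, as the elements of the image then avoid y at each of the centres. *)
Lemma patterns_reachable (N F D E0 : {fset G}) (s : G -> rule A M) c (y : G -> A) :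
  sofic R G -> 1 \in N -> 1 \in F -> (F `<=` D)%fset -> (E0 `<=` F)%fset ->
  (forall g, decoding_window N s g) -> decoding_window N (fun=> c) 1 ->
  (forall g, g \in (D `\` F)%fset -> s g = c) ->
  (forall f n n', f \in F -> n \in N -> n' \in N -> f * n^-1 * n' \in D) ->
  exists x, {in E0, nuca s x =1 y}.
Proof.
move=> sof N1 F1 FD E0F sN cN sc DN; apply: contrapT => unreached.
have D1 : 1 \in D := fsubsetP FD _ F1.
pose a := #|A|; pose b := (a ^ #|` E0|)%N.
have a0 : (0 < a)%N by apply/card_gt0P; exists (y 1).
have b0 : (0 < b)%N by rewrite expn_gt0 a0.
pose q := (#|` D| * #|` D|)%N.
have [L gap] := exp_gap a b0.
(* With q |Z| bounding the number n - r of good points, (q L + 2) r <= n forces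
   L r < |Z|. *)
have [n [act [n0 act_inj few_bad]]] :=
  sofic_model (transplant_window M N D) (q * L).+2 sof.
set good := model_point act (transplant_window M N D) in few_bad.
have [Z Zpack largeZ] := @large_packing _ _ act (transplant_window M N D) act_inj D D1.
have [ZW ZD] := packingP _ _ _ _ Zpack.
rewrite -/good -/q in largeZ ZW.
have card_good : (#|good| + #|~: good| = n)%N by rewrite cardsC card_ord.
have LZ : (L * #|~: good| < #|Z|)%N.
  rewrite ltnNge; apply/negP => small.
  have := leq_mul small (leqnn q); move: few_bad largeZ card_good n0.
  move: #|~: good| #|good| #|Z| q => r g k q'.
  rewrite (_ : (q' * L).+2 * r = L * r * q' + r + r)%N; last by lia.
  by case: r => [|r]; lia.
pose blk (z : 'I_n) (e : E0) := act (val e) z.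
have E0D e : e \in E0 -> e \in D by move=> eE; apply: (fsubsetP FD); apply: (fsubsetP E0F).
pose av := avoiding blk (fun e : E0 => y (val e)) Z.
have im_av : [set transplant F s c act Z w | w in [set: {ffun 'I_n -> A}]]%SET \subset av.
  apply/fintype.subsetP => _ /imsetP[w _ ->]; rewrite inE; apply/forall_inP => z zZ.
  apply/existsP; apply: contrapT => hit; apply: unreached.
  exists (fun h => w (act h z)) => e eE0.
  rewrite -(transplant_inside FD sc Zpack) ?E0D //.
  apply: contrapT => /eqP ne; apply: hit; exists [` eE0]%fset.
  by rewrite ne.
have im_le := card_transplant_image N1 FD sN cN sc DN act_inj Zpack.
have av_le : (b ^ #|Z| * #|av| <= b.-1 ^ #|Z| * a ^ n)%N.
  rewrite -[X in (_ <= _ * _ ^ X)%N](card_ord n) /b cardfE.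
  apply: card_avoiding => [z zZ e e' ee'|z z' zZ z'Z zz' e e' ee'].
    apply/val_inj/(model_point_inj (fintype.subsetP ZW _ zZ)) => //.
      by rewrite !inE E0D ?fsvalP.
    by rewrite !inE E0D ?fsvalP.
  by move/eqP: zz'; apply; apply: ZD ee' => //; rewrite E0D ?fsvalP.
have := exp_gap_lt b0 gap LZ; rewrite ltnNge => /negP; apply.
rewrite card_ord -/good -/a in im_le.
rewrite -(leq_pmul2l (_ : 0 < a ^ n)%N) ?expn_gt0 ?a0 //.
apply: leq_trans (leq_mul im_le (leqnn _)) _.
apply: leq_trans (leq_mul (leq_mul (subset_leq_card im_av) (leqnn _)) (leqnn _)) _.
rewrite mulnC mulnA [leqRHS]mulnC -[leqRHS]mulnA [leqRHS]mulnC.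
exact: leq_mul av_le (leqnn _).
Qed.

Lemma nuca_range_closed (s : G -> rule A M) y :
  (forall E, exists x, {in E : {fset G}, nuca s x =1 y}) -> exists x, nuca s x = y.
Proof.
move=> /boolp.choice[x xP]; have [w wP] := finite_alphabet_cluster x.
exists w; apply: funext => g.
have [E gE xw] := wP (g |` [fset g * m | m in M])%fset.
rewrite -(xP E g); last by apply: (fsubsetP gE); rewrite !inE eqxx.
by apply: eq_nuca => // m mM; rewrite xw // !inE in_imfset ?orbT.
Qed.

Lemma injective_nuca_finite (s : G -> rule A M) (F : {fset G}) :
  (forall g, g \in F) -> injective (nuca s) -> forall y, exists x, nuca s x = y.
Proof.
move=> FG sinj y.
pose ext (u : {ffun F -> A}) : G -> A := fun g => u [` FG g]%fset.
pose res (x : G -> A) : {ffun F -> A} := [ffun f => x (val f)].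
have resK : cancel res ext by move=> x; apply: funext => g; rewrite /ext ffunE.
have extK : cancel ext res.
  by move=> u; apply/ffunP => f; rewrite ffunE /ext; congr (u _); apply: val_inj.
have rs_inj : injective (res \o nuca s \o ext).
  by apply: inj_comp (can_inj extK); apply: inj_comp sinj; apply: can_inj resK.
have [inv _ invK] := injF_bij rs_inj.
by exists (ext (inv (res y))); apply: (can_inj resK); apply: invK.
Qed.

Definition symmetrize (X : {fset G}) : {fset G} :=
  (1 |` (X `|` [fset g^-1 | g in X]))%fset.

Lemma symmetrizeV X g : g \in symmetrize X -> g^-1 \in symmetrize X.
Proof.
rewrite !inE => /or3P[/eqP->|gX|/imfsetP[h /= hX ->]].
- by rewrite invg1 eqxx.
- by rewrite (in_imfset _ _ gX) !orbT.
- by rewrite invgK hX !orbT.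
Qed.

Lemma symmetrize_symmetric X :
  symmetrize X = [fset g^-1 | g in symmetrize X]%fset.
Proof.
apply/fsetP => g; apply/idP/imfsetP => [gX|[h /= hX ->]]; last exact: symmetrizeV.
by exists g^-1; rewrite ?invgK //; apply: symmetrizeV.
Qed.

Lemma fset_productP (X Y : {fset G}) k : reflect
  (exists f e, [/\ f \in X, e \in Y & k = f * e])
  (k \in [fset f * e | f in X, e in Y]%fset).
Proof.
apply: (iffP (imfset2P _ _ _ _ _)) => [[f fX [e eY ->]]|[f [e [fX eY ->]]]].
  by exists f, e.
by exists f => //; exists e.
Qed.

(** If P = FU is stable under multiplication by U, it is stable under the group
    generated by U, which is all of G; as P contains 1, it is then all of G. *)
Lemma generated_escape (K U F : {fset G}) :
    (forall H : set G, group_closed (mem H) -> {subset K <= H} -> H = [set: G]%classic) ->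
    {subset K <= symmetrize U} -> 1 \in F ->
  let P := [fset f * u | f in F, u in symmetrize U]%fset in
  (forall g, g \in P) \/
  exists p u, [/\ p \in P, u \in symmetrize U & p * u \notin P].
Proof.
move=> genK KU F1 P; apply: contrapT => /not_orP[notall noesc]; apply: notall.
have stab p u : p \in P -> u \in symmetrize U -> p * u \in P.
  by move=> pP uU; apply: contrapT => /negP out; apply: noesc; exists p, u.
pose H : set G := [set h | forall p, p \in P -> p * h \in P /\ p * h^-1 \in P]%classic.
have HT : H = [set: G]%classic.
  apply: genK; last first.
    by move=> k /KU kU; apply/mem_set => p pP; rewrite !stab ?symmetrizeV.
  split; first by apply/mem_set => p pP; rewrite invg1 mulg1.
  move=> h k /set_mem hH /set_mem kH; apply/mem_set => p pP.
  split; first by rewrite mulgA; apply: (kH _ _).2; apply: (hH _ _).1.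
  by rewrite invMg invgK mulgA; apply: (hH _ _).2; apply: (kH _ _).1.
have P1 : 1 \in P by apply/fset_productP; exists 1, 1; rewrite F1 !inE eqxx mulg1.
move=> g; have : H g by rewrite HT.
by move=> /(_ 1 P1)[]; rewrite mul1g.
Qed.

(** The neighbourhood E contains VVV, where V is a symmetric set that contains N,
    the generators and the pattern support.  Unless G = FV, a
    point g0 of FVV outside FV has its window g0 N inside FVVV and outside F, so
    that s is constant on it; this makes c = s(g0) decodable.  When G = FV, it
    is finite and injectivity alone is enough. *)
Lemma nuca_surjective (s : G -> rule A M) (N : {fset G}) :
  finitely_generated G -> sofic R G -> uniformly_bounded_singularity s ->
  1 \in N -> (forall g, decoding_window N s g) -> forall y, exists x, nuca s x = y.
Proof.
move=> [K genK] sof ubs N1 sN y; apply: nuca_range_closed => E0.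
pose U := (N `|` K `|` E0)%fset; pose V := symmetrize U.
have V1 : 1 \in V by rewrite !inE eqxx.
have UV g : g \in U -> g \in V by rewrite [g \in V]in_fset1U in_fsetU => ->; rewrite orbT.
have NV n : n \in N -> n \in V by move=> nN; apply: UV; rewrite !inE nN.
have VV := @symmetrizeV U.
pose E := symmetrize [fset v * v' | v in [fset v * v' | v in V, v' in V], v' in V]%fset.
have VE v1 v2 v3 : v1 \in V -> v2 \in V -> v3 \in V -> v1 * v2 * v3 \in E.
  move=> V1' V2 V3; rewrite in_fset1U in_fsetU; apply/or3P; apply: Or32.
  by apply/fset_productP; exists (v1 * v2), v3; split=> //; apply/fset_productP; exists v1, v2.
have E1 : 1 \in E by rewrite in_fset1U eqxx.
have [F [EF sF]] := ubs E E1 (symmetrize_symmetric _).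
have F1 : 1 \in F := fsubsetP EF _ E1.
have KV : {subset K <= V} by move=> k kK; apply: UV; rewrite !inE kK orbT.
have [cover|[p [u [/fset_productP[f [v [fF vV ->]]] uV out]]]] :=
  generated_escape genK KV F1.
  have sinj : injective (nuca s).
    by move=> x x' xx'; apply: funext => g; apply: sN => n _; rewrite xx'.
  by have [x <-] := injective_nuca_finite cover sinj y; exists x.
pose D := [fset f * e | f in F, e in E]%fset.
have inD f' e : f' \in F -> e \in E -> f' * e \in D.
  by move=> f'F eE; apply/fset_productP; exists f', e.
pose g0 := f * v * u.
have g0D n : n \in N -> g0 * n \in (D `\` F)%fset.
  move=> nN; have vunE : v * u * n \in E by rewrite VE // NV.
  rewrite in_fsetD /g0 -!mulgA inD ?mulgA // andbT; apply/negP => gF.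
  move/negP: out; apply; apply/fset_productP; exists (f * v * u * n), n^-1.
  by rewrite gF VV ?NV // mulgK.
have g0in : g0 \in (D `\` F)%fset by rewrite -[g0]mulg1 g0D.
clearbody g0; apply: (@patterns_reachable N F D E0 s (s g0) y sof N1 F1) => //.
- by apply/fsubsetP => h hF; rewrite -[h]mulg1 inD.
- apply/fsubsetP => e eE0; apply: (fsubsetP EF).
  by have := VE e 1 1; rewrite !mulg1; apply=> //; rewrite UV // !inE eE0 orbT.
- move=> x x' xx'.
  have := sN g0 (fun h => x (g0^-1 * h)) (fun h => x' (g0^-1 * h)).
  rewrite mulVg; apply => n nN.
  have -> : nuca s (fun h => x (g0^-1 * h)) (g0 * n) = nuca (fun=> s g0) x (1 * n).
    by apply: eq_nuca => [|m _]; [apply: sF; rewrite ?g0D|rewrite !mulgA mulVg].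
  rewrite xx' //; symmetry.
  by apply: eq_nuca => [|m _]; [apply: sF; rewrite ?g0D|rewrite !mulgA mulVg].
- by move=> g gD; apply: sF.
- move=> f' n n' f'F nN n'N; rewrite -mulgA inD //.
  by rewrite -[_ * n']mulg1 VE ?VV ?NV.
Qed.

End Surjectivity.

Theorem theoremB (R : realType) (G : groupType) (M : {fset G}) (A : finType)
    (s : G -> rule A M) :
  finitely_generated G -> sofic R G ->
  uniformly_bounded_singularity s -> stably_injective s ->
  stably_invertible s.
Proof.
move=> fgG sofG ubs sinj.
have [N N1 sN] := stably_injective_window sinj.
have ss : orbit_closure s s := @orbit_closure_refl _ _ s.
have tK := decodingK N1 sN ss.
have sK : nuca s \o nuca (decoding N1 s) = id.
  apply: funext => y /=.
  have [x <-] := nuca_surjective fgG sofG ubs N1 (fun=> decoding_window_translate sN ss) y.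
  by have := congr1 (@^~ x) tK => /= ->.
exists N, (decoding N1 s) => p sp; exists (decoding N1 p); split.
  exact: decoding_orbit_closure.
by split; [apply: decoding_right_inverse sp sK|apply: decodingK sN _ sp].
Qed.
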